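(* Let $G$ be a finite group, let $*$ be a nonidentical involutory antiautomorphism of $G$ with $gg^*\in Z(G)$ for every $g\in G$, and let $g_0\in Z(G)$ with $g_0^*=g_0$. Let $\beta\in\{xy,\,x^*y,\,yx,\,yx^*\}$, $\gamma\in\{xy,\,yx\}$ and $\delta\in\{g_0xy,\,g_0xy^*,\,g_0x^*y,\,g_0x^*y^*,\,g_0yx,\,g_0yx^*,\,g_0y^*x,\,g_0y^*x^*\}$. Then the loop $L=Q(G,*,g_0,\beta,\gamma,\delta)$ is a middle nuclear square loop if and only if at least one of the following holds: (a) $L$ is an LC-loop or an RC-loop; (b) $(\beta,\gamma,\delta)$ is among $(xy,xy,g_0y^*x^* )$, $(yx^*,xy,g_0xy^* )$, $(yx^*,xy,g_0yx^* )$; (c) $G/Z(G)$ is an elementary abelian $2$-group and $(\beta,\gamma,\delta)$ is among $(xy,xy,g_0x^*y^* )$, $(xy,xy,g_0yx)$, $(xy,yx,g_0x^*y^* )$, $(xy,yx,g_0y^*x^* )$, $(x^*y,xy,g_0xy^* )$, $(x^*y,xy,g_0y^*x)$, $(x^*y,yx,g_0xy^* )$, $(x^*y,yx,g_0x^*y)$, $(x^*y,yx,g_0y^*x)$, $(yx,xy,g_0x^*y^* )$, $(yx,xy,g_0y^*x^* )$, $(yx,yx,g_0xy)$, $(yx,yx,g_0x^*y^* )$, $(yx,yx,g_0y^*x^* )$, $(yx^*,xy,g_0y^*x)$, $(yx^*,yx,g_0xy^* )$, $(yx^*,yx,g_0y^*x)$; (d) $G/Z(G)$ is an elementary abelian $2$-group,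 $(xx)^*=xx$ for every $x\in G$, and $(\beta,\gamma,\delta)$ is among $(xy,xy,g_0yx^* )$, $(xy,xy,g_0y^*x)$, $(xy,yx,g_0x^*y)$, $(xy,yx,g_0y^*x)$, $(x^*y,xy,g_0x^*y^* )$, $(x^*y,xy,g_0yx)$, $(x^*y,yx,g_0xy)$, $(x^*y,yx,g_0x^*y^* )$, $(yx,xy,g_0xy^* )$, $(yx,xy,g_0yx^* )$, $(yx,yx,g_0xy^* )$, $(yx,yx,g_0x^*y)$, $(yx^*,xy,g_0yx)$, $(yx^*,xy,g_0y^*x^* )$, $(yx^*,yx,g_0xy)$, $(yx^*,yx,g_0y^*x^* )$.
   Context: $Z(G)$ is the center of $G$. An involutory antiautomorphism $*$ of $G$ satisfies $(g^* )^*=g$ and $(gh)^*=h^*g^*$; nonidentical means $g^*\neq g$ for some $g\in G$. A word such as $yx^*$ or $g_0y^*x$ denotes the function $G\times G\to G$ sending $(x,y)$ to the value of the word. Words are regarded as functions: two words are identified when they define the same function on $G\times G$ (for instance $xy$ and $yx$ when $G$ is commutative), and equality of triples $(\beta,\gamma,\delta)$ means equality of the three functions. Let $Gu=\{gu : g\in G\}$ be a disjoint copy of $G$. The loop $Q(G,*,g_0,\beta,\gamma,\delta)$ is the set $G\cup Gu$ with the multiplication, for $x,y\in G$, $$x\circ y=xy,\quad x\circ yu=\beta(x,y)u,\quad xu\circ y=\gamma(x,y)u,\quad xu\circ yu=\delta(x,y).$$ It is a loop with neutral element $1\in G$. The trivial group counts as an elementary abelian $2$-group. A loop is a middle nuclear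 square loop if it satisfies $x((yy)z)=(x(yy))z$, an LC-loop if it satisfies $(xx)(yz)=(x(xy))z$, and an RC-loop if it satisfies $x((yz)z)=(xy)(zz)$. *)

(* Defs.v *)
From mathcomp Require Import all_boot all_fingroup all_solvable.

Set Implicit Arguments.
Unset Strict Implicit.
Unset Printing Implicit Defensive.

Local Open Scope group_scope.

Definition is_loop (T : Type) (op : T -> T -> T) (e : T) : Prop :=
  [/\ left_id e op,
      right_id e op,
      forall a b, exists! x, op a x = b
    & forall a b, exists! y, op y a = b].

Definition middle_nuclear_square_loop T (op : T -> T -> T) e : Prop :=
  is_loop op e /\
  forall x y z, op x (op (op y y) z) = op (op x (op y y)) z.

Definition LC_loop T (op : T -> T -> T) e : Prop :=
  is_loop op e /\
  forall x y z, op (op x x) (op y z) = op (op x (op x y)) z.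

Definition RC_loop T (op : T -> T -> T) e : Prop :=
  is_loop op e /\
  forall x y z, op x (op (op y z) z) = op (op x y) (op z z).

(* Words are finite functions, so that equality of words (and of triples of
   words) is equality of the functions they define on G x G. *)
Definition word (gT : finGroupType) := {ffun gT * gT -> gT}.

Section Words.

Variables (gT : finGroupType) (star : gT -> gT) (g0 : gT).

(* The letter s after x or y in a name stands for the star. *)
Definition xy : word gT := [ffun p => p.1 * p.2].
Definition xys : word gT := [ffun p => p.1 * star p.2].
Definition xsy : word gT := [ffun p => star p.1 * p.2].
Definition xsys : word gT := [ffun p => star p.1 * star p.2].
Definition yx : word gT := [ffun p => p.2 * p.1].
Definition yxs : word gT := [ffun p => p.2 * star p.1].
Definition ysx : word gT := [ffun p => star p.2 * p.1].
Definition ysxs : word gT := [ffun p => star p.2 * star p.1].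

Definition g0w (w : word gT) : word gT := [ffun p => g0 * w p].

Definition betas : seq (word gT) := [:: xy; xsy; yx; yxs].

Definition gammas : seq (word gT) := [:: xy; yx].

Definition deltas : seq (word gT) :=
  [:: g0w xy; g0w xys; g0w xsy; g0w xsys; g0w yx; g0w yxs; g0w ysx; g0w ysxs].

Definition triples_b : seq (word gT * word gT * word gT) :=
  [:: (xy, xy, g0w ysxs); (yxs, xy, g0w xys); (yxs, xy, g0w yxs)].

Definition triples_c : seq (word gT * word gT * word gT) :=
  [:: (xy, xy, g0w xsys);   (xy, xy, g0w yx);
      (xy, yx, g0w xsys);   (xy, yx, g0w ysxs);
      (xsy, xy, g0w xys);   (xsy, xy, g0w ysx);
      (xsy, yx, g0w xys);   (xsy, yx, g0w xsy);   (xsy, yx, g0w ysx);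
      (yx, xy, g0w xsys);   (yx, xy, g0w ysxs);
      (yx, yx, g0w xy);     (yx, yx, g0w xsys);   (yx, yx, g0w ysxs);
      (yxs, xy, g0w ysx);
      (yxs, yx, g0w xys);   (yxs, yx, g0w ysx)].

Definition triples_d : seq (word gT * word gT * word gT) :=
  [:: (xy, xy, g0w yxs);    (xy, xy, g0w ysx);
      (xy, yx, g0w xsy);    (xy, yx, g0w ysx);
      (xsy, xy, g0w xsys);  (xsy, xy, g0w yx);
      (xsy, yx, g0w xy);    (xsy, yx, g0w xsys);
      (yx, xy, g0w xys);    (yx, xy, g0w yxs);
      (yx, yx, g0w xys);    (yx, yx, g0w xsy);
      (yxs, xy, g0w yx);    (yxs, xy, g0w ysxs);
      (yxs, yx, g0w xy);    (yxs, yx, g0w ysxs)].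

End Words.

Section Doubling.

Variables (gT : finGroupType) (beta gamma delta : word gT).

(* The disjoint union of G and Gu: inl g is g and inr g is gu.  The parameters
   * and g0 of Q(G,*,g0,beta,gamma,delta) enter only through the words. *)
Definition Qmul (a b : gT + gT) : gT + gT :=
  match a, b with
  | inl x, inl y => inl (x * y)
  | inl x, inr y => inr (beta (x, y))
  | inr x, inl y => inr (gamma (x, y))
  | inr x, inr y => inl (delta (x, y))
  end.

Definition Qone : gT + gT := inl 1.

End Doubling.

Arguments Qone {gT}.

(* Main.v *)
(* The squares of L lie in G, so the middle nuclear square law only involves
   elements s of G with s = y^2 or s = delta(y, y).  Unless (beta, gamma, delta)
   is (xy, xy, g0 xy) or listed in (b), the instances with s = y^2 and with 1 or
   u for one of the outer variables force y^2 to be central, and also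
   (y^2)^* = y^2 if the total number of stars on x in beta and on x and y in
   delta is odd.  Conversely, once squares are central, so are the commutators,
   which have order at most 2, and the x^-1 x^*; an identity between words in
   x, y, z and their stars can then be decided by counting letters and
   inversions.  This decides LC, RC and the middle nuclear square law for all 64
   triples under the conditions just derived. *)
Require Import Defs.
From mathcomp Require Import all_boot all_fingroup all_solvable.

Set Implicit Arguments.
Unset Strict Implicit.
Unset Printing Implicit Defensive.

(** * Middle nuclear squares in LC- and RC-loops *)

Lemma is_loop_flip (T : Type) (op : T -> T -> T) (e : T) :
  is_loop op e -> is_loop (fun x y => op y x) e.
Proof. by case. Qed.

Lemma loop_lcancel (T : Type) (op : T -> T -> T) (e a : T) :
  is_loop op e -> injective (op a).
Proof.
case=> _ _ lsol _ x y eq_xy.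
by have [z [_ uniq_z]] := lsol a (op a x); rewrite -(uniq_z x) ?(uniq_z y).
Qed.

(* LC gives the left inverse property, so the inverse of L_(x(yy)) is
   L_(y^-1) L_(y^-1) L_(x^-1) and L_(x(yy)) = L_x L_y L_y = L_x L_(yy). *)
Lemma LC_middle_nuclear_square (T : Type) (op : T -> T -> T) (e : T) :
  LC_loop op e -> middle_nuclear_square_loop op e.
Proof.
case=> opL LC; split=> //.
have lcancel a : injective (op a) := loop_lcancel opL.
case: opL => op1x opx1 lsol _.
have lalt x y : op (op x x) y = op x (op x y) by rewrite -{1}[y]opx1 LC opx1.
have LC' x y z : op (op x (op x y)) z = op x (op x (op y z)).
  by rewrite -LC lalt.
have linv x x' z : op x x' = e -> op x (op x' z) = z.
  by move=> xx'; apply: (lcancel x); rewrite -LC' xx' opx1.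
have linv' x x' z : op x x' = e -> op x' (op x z) = z.
  by move=> xx'; apply: (lcancel x); rewrite linv.
move=> x y z.
have [x' [xx' _]] := lsol x e; have [y' [yy' _]] := lsol y e.
pose w' := op y' (op y' x').
have w'E u : op w' (op x u) = op y' (op y' u) by rewrite /w' LC' (linv' x).
have w'w : op w' (op x (op y y)) = e.
  by rewrite w'E (linv' y) // -{1}[y]opx1 linv'.
by apply: (lcancel w'); rewrite (linv _ _ z w'w) w'E lalt !(linv' y).
Qed.

(** The opposite of an RC-loop is an LC-loop, and the middle nuclear square law is its own
    opposite. *)
Lemma RC_middle_nuclear_square (T : Type) (op : T -> T -> T) (e : T) :
  RC_loop op e -> middle_nuclear_square_loop op e.
Proof.
case=> opL RC; have opL' := is_loop_flip opL.
have [|_ MNS] := @LC_middle_nuclear_square _ (fun x y => op y x) e.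
  by split=> // x y z; rewrite RC.
by split=> // x y z; rewrite MNS.
Qed.

(* (sx, sy, swap) stands for the word in x and y in which x (resp. y) is starred
   if sx (resp. sy) holds, and y comes first if swap holds. *)
Definition word_code := (bool * bool * bool)%type.

(* The factor g0 of delta is left implicit. *)
Definition triple_code := (word_code * word_code * word_code)%type.

(** * Doubling over an arbitrary carrier *)

Section Doubling.

Variables (T : Type) (mul : T -> T -> T) (star mul0 : T -> T).

Definition star_if (s : bool) (x : T) : T := if s then star x else x.

Definition twisted (w : word_code) (x y : T) : T :=
  let: (sx, sy, swap) := w in
  if swap then mul (star_if sy y) (star_if sx x)
  else mul (star_if sx x) (star_if sy y).

(** The carrier is left abstract so that the same multiplication runs on [G] and on symbolic words;
    [mul0] is multiplication by [g0]. *)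
Definition double (t : triple_code) (a b : T + T) : T + T :=
  let: (beta, gamma, delta) := t in
  match a, b with
  | inl x, inl y => inl (mul x y)
  | inl x, inr y => inr (twisted beta x y)
  | inr x, inl y => inr (twisted gamma x y)
  | inr x, inr y => inl (mul0 (twisted delta x y))
  end.

End Doubling.

Definition sum_map (S T : Type) (f : S -> T) (a : S + S) : T + T :=
  match a with inl x => inl (f x) | inr x => inr (f x) end.

Section DoubleMorphism.

Variables (S T : Type) (mulS : S -> S -> S) (starS mul0S : S -> S).
Variables (mulT : T -> T -> T) (starT mul0T : T -> T) (f : S -> T).
Hypotheses (fM : {morph f : x y / mulS x y >-> mulT x y}).
Hypotheses (f_star : {morph f : x / starS x >-> starT x}).
Hypotheses (f_mul0 : {morph f : x / mul0S x >-> mul0T x}).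

Lemma twisted_morph w :
  {morph f : x y / twisted mulS starS w x y >-> twisted mulT starT w x y}.
Proof. by case: w => [[[] []] []] x y /=; rewrite fM ?f_star. Qed.

Lemma double_morph t :
  {morph sum_map f : a b /
    double mulS starS mul0S t a b >-> double mulT starT mul0T t a b}.
Proof.
by case: t => [[beta gamma] delta] [x|x] [y|y] /=;
  rewrite ?f_mul0 ?fM ?twisted_morph.
Qed.

End DoubleMorphism.

(** * Loop identities as terms, and symbolic words to evaluate them on *)

Inductive term := Var of nat | Mul of term & term.

Fixpoint teval (T : Type) (op : T -> T -> T) (v : nat -> T) (t : term) : T :=
  match t with
  | Var i => v i
  | Mul a b => op (teval op v a) (teval op v b)
  end.

Lemma teval_morph (S T : Type) (opS : S -> S -> S) (opT : T -> T -> T) f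
    (v : nat -> S) t :
  {morph f : a b / opS a b >-> opT a b} ->
  f (teval opS v t) = teval opT (f \o v) t.
Proof. by move=> fM; elim: t => //= a IHa b IHb; rewrite fM IHa IHb. Qed.

Lemma eq_teval (T : Type) (op : T -> T -> T) (v v' : nat -> T) t :
  v =1 v' -> teval op v t = teval op v' t.
Proof. by move=> eq_v; elim: t => //= a -> b ->. Qed.

Definition LC_id : term * term :=
  let x := Var 0 in let y := Var 1 in let z := Var 2 in
  (Mul (Mul x x) (Mul y z), Mul (Mul x (Mul x y)) z).

Definition RC_id : term * term :=
  let x := Var 0 in let y := Var 1 in let z := Var 2 in
  (Mul x (Mul (Mul y z) z), Mul (Mul x y) (Mul z z)).

Definition MNS_id : term * term :=
  let x := Var 0 in let y := Var 1 in let z := Var 2 in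
  (Mul x (Mul (Mul y y) z), Mul (Mul x (Mul y y)) z).

Definition pick3 (T : Type) (x y z : T) (i : nat) : T :=
  match i with 0 => x | 1 => y | _ => z end.

(* The pair (i, s) is the i-th letter, starred if s holds. *)
Definition letters := seq (nat * bool).

(* (n, w) stands for g0 ^+ n times the value of w. *)
Definition sym := (nat * letters)%type.

Definition sym_mul (a b : sym) : sym := ((a.1 + b.1), a.2 ++ b.2).

Definition sym_star (a : sym) : sym :=
  (a.1, rev [seq (l.1, ~~ l.2) | l <- a.2]).

Definition sym_mul0 (a : sym) : sym := (a.1.+1, a.2).

(* When squares and all g g^* are central, so are the x^-1 x^* and the
   commutators, and the latter square to 1.  A word is then determined by the
   degree of each letter, the number of its starred occurrences, and the parity
   of the number of inversions of each pair of letters. *)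
Record normal_form := NF {
  degs : nat * nat * nat;
  stars : nat * nat * nat;
  invs : nat * nat * nat
}.

(** The target order is x, y, z: a letter put in front crosses every smaller letter behind it, at
    the cost of one inversion each. *)
Fixpoint nf (w : letters) : normal_form :=
  if w is (i, s) :: w' then
    let: NF (nx, ny, nz) (sx, sy, sz) (ixy, ixz, iyz) := nf w' in
    match i with
    | 0 => NF (nx.+1, ny, nz) (s + sx, sy, sz) (ixy, ixz, iyz)
    | 1 => NF (nx, ny.+1, nz) (sx, s + sy, sz) (nx + ixy, ixz, iyz)
    | _ => NF (nx, ny, nz.+1) (sx, sy, s + sz) (ixy, nx + ixz, ny + iyz)
    end
  else NF (0, 0, 0) (0, 0, 0) (0, 0, 0).

Definition odd3 (n : nat * nat * nat) :=
  let: (a, b, c) := n in (odd a, odd b, odd c).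

(** At level 1 star counts are compared exactly, since x^-1 x^* need not square to 1; once squares
    are fixed by the star it does, and parities suffice. *)
Definition nf_eq (lvl : nat) (m n : normal_form) :=
  [&& degs m == degs n,
      if lvl is 1 then stars m == stars n else odd3 (stars m) == odd3 (stars n)
    & odd3 (invs m) == odd3 (invs n)].

(* Level 0 is for arbitrary G, level 1 for central squares, and level 2 for
   squares that are central and fixed by the star. *)
Definition sym_eq (lvl : nat) (a b : sym) :=
  (a.1 == b.1) &&
  (if lvl is 0 then a.2 == b.2 else nf_eq lvl (nf a.2) (nf b.2)).

(** * Codes of the listed triples, and the symbolic check *)

Definition cxy : word_code := (false, false, false).
Definition cxys : word_code := (false, true, false).
Definition cxsy : word_code := (true, false, false).
Definition cxsys : word_code := (true, true, false).
Definition cyx : word_code := (false, false, true).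
Definition cyxs : word_code := (true, false, true).
Definition cysx : word_code := (false, true, true).
Definition cysxs : word_code := (true, true, true).

Definition codes_b : seq triple_code :=
  [:: (cxy, cxy, cysxs); (cyxs, cxy, cxys); (cyxs, cxy, cyxs)].

Definition codes_c : seq triple_code :=
  [:: (cxy, cxy, cxsys);   (cxy, cxy, cyx);
      (cxy, cyx, cxsys);   (cxy, cyx, cysxs);
      (cxsy, cxy, cxys);   (cxsy, cxy, cysx);
      (cxsy, cyx, cxys);   (cxsy, cyx, cxsy);   (cxsy, cyx, cysx);
      (cyx, cxy, cxsys);   (cyx, cxy, cysxs);
      (cyx, cyx, cxy);     (cyx, cyx, cxsys);   (cyx, cyx, cysxs);
      (cyxs, cxy, cysx);
      (cyxs, cyx, cxys);   (cyxs, cyx, cysx)].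

Definition codes_d : seq triple_code :=
  [:: (cxy, cxy, cyxs);    (cxy, cxy, cysx);
      (cxy, cyx, cxsy);    (cxy, cyx, cysx);
      (cxsy, cxy, cxsys);  (cxsy, cxy, cyx);
      (cxsy, cyx, cxy);    (cxsy, cyx, cxsys);
      (cyx, cxy, cxys);    (cyx, cxy, cyxs);
      (cyx, cyx, cxys);    (cyx, cyx, cxsy);
      (cyxs, cxy, cyx);    (cyxs, cxy, cysxs);
      (cyxs, cyx, cxy);    (cyxs, cyx, cysxs)].

(* The level (as in sym_eq) at which the middle nuclear square law holds.  For
   central s the two members of its instance xu(s(zu)) = ((xu)s)(zu) contain s
   and s, or s and s^*, according to the parity computed here. *)
Definition required_level (t : triple_code) : nat :=
  let: ((bs, _, _), _, (ds, ds', _)) := t in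
  if t \in (cxy, cxy, cxy) :: codes_b then 0
  else if bs (+) ds (+) ds' then 2 else 1.

Definition admissible_code (bs bw cw ds ds' dw : bool) : triple_code :=
  ((bs, false, bw), (false, false, cw), (ds, ds', dw)).

Definition sum_eq (lvl : nat) (a b : sym + sym) :=
  match a, b with
  | inl x, inl y | inr x, inr y => sym_eq lvl x y
  | _, _ => false
  end.

Definition sided (T : Type) (s : bool) (x : T) : T + T :=
  if s then inr x else inl x.

Definition sym_vars (a b c : bool) : nat -> sym + sym :=
  let letter s i := sided s (0, [:: (i, false)]) in
  pick3 (letter a 0) (letter b 1) (letter c 2).

Definition check_sides (lvl : nat) t (id : term * term) (a b c : bool) :=
  let ev := teval (double sym_mul sym_star sym_mul0 t) (sym_vars a b c) in
  sum_eq lvl (ev id.1) (ev id.2).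

Definition check (lvl : nat) t (id : term * term) :=
  let all_bool (p : bool -> bool) := p false && p true in
  all_bool (fun a => all_bool (fun b => all_bool (check_sides lvl t id a b))).

Lemma check_sidesP (lvl : nat) t id a b c :
  check lvl t id -> check_sides lvl t id a b c.
Proof.
case/andP=> /andP[/andP[? ?] /andP[? ?]] /andP[/andP[? ?] /andP[? ?]].
by case: a; case: b; case: c.
Qed.

Local Open Scope group_scope.

(** * Values of symbolic words in [G] *)

Section Group.

Variables (gT : finGroupType) (star : gT -> gT) (g0 : gT).
Hypothesis starK : forall g, star (star g) = g.
Hypothesis starM : forall g h, star (g * h) = star h * star g.
Hypothesis star_central : forall g, g * star g \in 'Z([set: gT]).
Hypothesis g0_central : g0 \in 'Z([set: gT]).
Hypothesis g0_star : star g0 = g0.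

Local Notation Z := 'Z([set: gT]).

Lemma centralP (c : gT) : reflect (forall x, c * x = x * c) (c \in Z).
Proof.
apply: (iffP (centerP _ _)) => [[_ cC] x | cC]; first exact/cC.
by split=> // x _; apply: cC.
Qed.

Lemma central_mulgCA (c x y : gT) : c \in Z -> x * (c * y) = c * (x * y).
Proof. by move=> /centralP cC; rewrite !mulgA cC. Qed.

Lemma central_expM (c x y : gT) m n :
  c \in Z -> c ^+ m * x * (c ^+ n * y) = c ^+ (m + n) * (x * y).
Proof.
by move=> cZ; rewrite expgD -!mulgA (@central_mulgCA (c ^+ n)) ?groupX.
Qed.

Lemma star1 : star 1 = 1.
Proof. by apply: (mulIg (star 1)); rewrite -starM !mul1g. Qed.

Lemma star_inj : injective star.
Proof. exact: can_inj starK. Qed.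

Section Letters.

Variables x y z : gT.

Definition letter_val (l : nat * bool) : gT :=
  star_if star l.2 (pick3 x y z l.1).

Definition word_val (w : letters) : gT := \prod_(l <- w) letter_val l.

Definition sym_val (a : sym) : gT := g0 ^+ a.1 * word_val a.2.

Lemma sym_valM : {morph sym_val : a b / sym_mul a b >-> a * b}.
Proof.
by move=> a b; rewrite /sym_val /word_val big_cat /= central_expM.
Qed.

Lemma word_val_star w :
  word_val (rev [seq (l.1, ~~ l.2) | l <- w]) = star (word_val w).
Proof.
elim: w => [|[i s] w IHw]; first by rewrite /word_val !big_nil star1.
rewrite /= rev_cons -cats1 /word_val big_cat /= big_seq1 big_cons starM.
rewrite -[X in X * _]/(word_val _) IHw; congr (_ * _).
by rewrite /letter_val; case: s => /=; rewrite ?starK.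
Qed.

Lemma sym_val_star : {morph sym_val : a / sym_star a >-> star a}.
Proof.
case=> n w; rewrite /sym_val /= word_val_star starM.
suff ->: star (g0 ^+ n) = g0 ^+ n.
  by have /centralP->: g0 ^+ n \in Z by rewrite groupX.
by elim: n => [|n IHn]; rewrite ?star1 // {1}expgSr starM g0_star IHn -expgS.
Qed.

Lemma sym_val_mul0 : {morph sym_val : a / sym_mul0 a >-> g0 * a}.
Proof. by move=> a; rewrite /sym_val expgS -mulgA. Qed.

End Letters.

Definition squares_central := forall g : gT, g * g \in Z.

Definition squares_star_fixed := forall g, star (g * g) = g * g.

(** A group of exponent dividing 2 is abelian, so only the squares in the quotient matter. *)
Lemma abelem_squares_central : 2.-abelem ([set: gT] / Z) <-> squares_central.
Proof.
have inN (g : gT) : g \in 'N(Z).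
  by have /subsetP-> := normal_norm (center_normal [set: gT]); rewrite ?inE.
split=> [/abelemP[] // _ sq1 g | sqZ].
  have := sq1 (coset Z g) (mem_quotient _ (in_setT g)).
  by rewrite expgS expg1 -morphM // => /coset_idr; apply; apply: inN.
apply: exponent2_abelem; apply/exponentP=> _ /morphimP[g _ _ ->].
by rewrite expgS expg1 -morphM // [LHS]coset_id.
Qed.

(** * Normal forms of words when squares are central *)

Section CentralSquares.

Hypothesis sqZ : squares_central.

(** The commutator is a product of three squares: x^-2 (x y^-1)^2 y^2. *)
Lemma commg_central (x y : gT) : [~ x, y] \in Z.
Proof.
suff ->: [~ x, y] = x^-1 * x^-1 * (x * y^-1 * (x * y^-1)) * (y * y).
  exact: groupM (groupM (sqZ _) (sqZ _)) (sqZ _).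
by rewrite commgEl conjgE !mulgA !(mulgK, mulgKV).
Qed.

(** As the commutator is central, its square is [[~ x ^+ 2, y]], and x^2 is central. *)
Lemma commg_sqr (x y : gT) : [~ x, y] ^+ 2 = 1.
Proof.
rewrite -commXg; last by apply/esym/centralP/commg_central.
by apply/eqP/commgP; rewrite expgS expg1; apply/centralP.
Qed.

Definition star_defect (x : gT) := x^-1 * star x.

Lemma star_defect_central x : star_defect x \in Z.
Proof.
suff ->: star_defect x = x^-1 * x^-1 * (x * star x).
  exact: groupM (sqZ _) (star_central _).
by rewrite !mulgA mulgKV.
Qed.

Lemma star_if_defect s x : star_if star s x = x * star_defect x ^+ s.
Proof. by case: s; rewrite /= ?mulg1 // mulKVg. Qed.

(** By centrality of the defect, its square is x^-2 (x^2)^*. *)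
Lemma star_defect_sqr x : squares_star_fixed -> star_defect x ^+ 2 = 1.
Proof.
move=> sq_fixed; have /centralP cC := star_defect_central x.
rewrite expgS expg1 {1}/star_defect -mulgA -cC -mulgA -starM sq_fixed.
by rewrite mulKg mulVg.
Qed.

Section NormalForm.

Variables x y z : gT.

Definition central_val (s i : nat * nat * nat) : gT :=
  let: (sx, sy, sz) := s in
  let: (ixy, ixz, iyz) := i in
  star_defect x ^+ sx * (star_defect y ^+ sy * (star_defect z ^+ sz *
    ([~ y, x] ^+ ixy * ([~ z, x] ^+ ixz * [~ z, y] ^+ iyz)))).

Definition nf_val (n : normal_form) : gT :=
  let: NF (nx, ny, nz) s i := n in
  x ^+ nx * (y ^+ ny * (z ^+ nz * central_val s i)).

Lemma central_valD sx sy sz ixy ixz iyz sx' sy' sz' ixy' ixz' iyz' :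
  central_val (sx + sx', sy + sy', sz + sz')%N
    (ixy + ixy', ixz + ixz', iyz + iyz')%N
  = central_val (sx, sy, sz) (ixy, ixz, iyz)
    * central_val (sx', sy', sz') (ixy', ixz', iyz').
Proof.
by rewrite /= !central_expM ?star_defect_central ?commg_central // -expgD.
Qed.

Lemma central_val_central s i : central_val s i \in Z.
Proof.
case: s i => [[sx sy] sz] [[ixy ixz] iyz].
by rewrite !groupM ?groupX ?star_defect_central ?commg_central.
Qed.

Lemma mul_expg_comm (a b : gT) n : a * b ^+ n = b ^+ n * a * [~ a, b] ^+ n.
Proof.
by rewrite commgC commgX //; apply/esym/centralP/commg_central.
Qed.

Local Arguments central_val : simpl never.

(** [mul_expg_comm] carries the first letter past the powers of smaller letters; defects and
    commutators are central and are collected in [central_val]. *)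
Lemma word_val_nf w : word_val x y z w = nf_val (nf w).
Proof.
elim: w => [|[i s] w IHw].
  by rewrite /word_val big_nil /= /central_val !expg0 !mulg1.
rewrite /word_val big_cons -/(word_val x y z w) IHw /letter_val star_if_defect.
have dZ a : star_defect a ^+ s \in Z by rewrite groupX ?star_defect_central.
have cZ a b n : [~ a, b] ^+ n \in Z by rewrite groupX ?commg_central.
case: i => [|[|i]] /=;
  case: (nf w) => [[[nx ny] nz] [[sx sy] sz] [[ixy ixz] iyz]]; rewrite /nf_val.
(* In each case [central_valD] splits off the defect of the new letter together with the commutators
   of its crossings (none for [x]). *)
- have := central_valD s 0 0 0 0 0 sx sy sz ixy ixz iyz; rewrite !add0n => ->.
  rewrite [central_val (nat_of_bool s, _, _) _]/central_val !expg0 !mulg1.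
  by rewrite expgS -!mulgA !(central_mulgCA _ _ (dZ x)).
- have := central_valD 0 s 0 nx 0 0 sx sy sz ixy ixz iyz; rewrite !add0n => ->.
  rewrite [central_val (0, _, _) _]/central_val !expg0 !mulg1 !mul1g.
  rewrite -!mulgA -(central_mulgCA _ _ (dZ y)) [y * (_ * _)]mulgA
    (mul_expg_comm y x) expgS.
  rewrite -!mulgA !(central_mulgCA _ _ (dZ y)).
  by rewrite !(central_mulgCA _ _ (cZ y x nx)).
- have := central_valD 0 0 s 0 nx ny sx sy sz ixy ixz iyz; rewrite !add0n => ->.
  rewrite [central_val (0, _, _) _]/central_val !expg0 !mul1g.
  rewrite -!mulgA -(central_mulgCA _ _ (dZ z)) [z * (_ * _)]mulgA
    (mul_expg_comm z x) -!mulgA.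
  rewrite !(central_mulgCA _ _ (dZ z)) !(central_mulgCA _ _ (cZ z x nx)).
  rewrite [z * _]mulgA (mul_expg_comm z y) expgS -!mulgA.
  by rewrite !(central_mulgCA _ _ (cZ z y ny)).
Qed.

Lemma expg_odd (c : gT) m n : c ^+ 2 = 1 -> odd m = odd n -> c ^+ m = c ^+ n.
Proof.
move=> c2; rewrite -[in c ^+ m](odd_double_half m).
rewrite -[in c ^+ n](odd_double_half n) => ->.
by rewrite !expgD -!mul2n !expgM c2 !expg1n.
Qed.

(** The hypothesis on [lvl] reflects that [nf_eq] compares star counts modulo 2 at every level other
    than 1. *)
Lemma nf_eqP (lvl : nat) (m n : normal_form) :
  (lvl != 1%N -> squares_star_fixed) -> nf_eq lvl m n -> nf_val m = nf_val n.
Proof.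
case: m n => [dm sm [[a b] c]] [dn sn [[a' b'] c']] sq_fixed.
case/and3P=> /= /eqP-> stars_eq /eqP[a_eq b_eq c_eq].
rewrite /nf_val; case: dn => [[nx ny] nz]; do 3!congr (_ * _).
have com (u v : gT) i j : odd i = odd j -> [~ u, v] ^+ i = [~ u, v] ^+ j.
  exact: expg_odd (commg_sqr u v).
case: (eqVneq lvl 1%N) stars_eq sq_fixed =>
  [-> /eqP-> _ | lvl1 + /(_ isT) sq_fixed].
  case: sn => [[sx sy] sz]; rewrite /central_val.
  by rewrite (com _ _ _ _ a_eq) (com _ _ _ _ b_eq) (com _ _ _ _ c_eq).
have {lvl1} -> : (if lvl is 1 then sm == sn else odd3 sm == odd3 sn)
                 = (odd3 sm == odd3 sn) by case: lvl lvl1 => [|[]].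
case: sm sn => [[sx sy] sz] [[sx' sy'] sz'] /eqP[x_eq y_eq z_eq].
have def (u : gT) i j :
    odd i = odd j -> star_defect u ^+ i = star_defect u ^+ j.
  exact: expg_odd (star_defect_sqr u sq_fixed).
by rewrite /central_val (com _ _ _ _ a_eq) (com _ _ _ _ b_eq) (com _ _ _ _ c_eq)
  (def _ _ _ x_eq) (def _ _ _ y_eq) (def _ _ _ z_eq).
Qed.

End NormalForm.

End CentralSquares.

(** * Soundness of the check, and the loop axioms *)

Definition level (lvl : nat) :=
  (0 < lvl -> squares_central) /\ (1 < lvl -> squares_star_fixed).

Lemma sym_eqP x y z lvl a b :
  level lvl -> sym_eq lvl a b -> sym_val x y z a = sym_val x y z b.
Proof.
case: a b => [m v] [n w] [sqZ sq_fixed] /andP[/= /eqP-> eq_vw].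
rewrite /sym_val; congr (_ * _) => /=; case: lvl sqZ sq_fixed eq_vw => [|lvl].
  by move=> _ _ /eqP->.
move=> /(_ isT) sqZ sq_fixed; rewrite !word_val_nf //; apply: nf_eqP => //.
by case: lvl sq_fixed => // lvl ->.
Qed.

Definition op t := double *%g star ( *%g g0) t.

Definition identity (id : term * term) t := forall x y z : gT + gT,
  teval (op t) (pick3 x y z) id.1 = teval (op t) (pick3 x y z) id.2.

(** Any three elements are values of symbolic letters on suitable sides, and taking values is a
    morphism of doublings, so the eight symbolic equalities carry over. *)
Lemma check_identity lvl t id : level lvl -> check lvl t id -> identity id t.
Proof.
move=> lvlP chk.
have sidedE (a : gT + gT) : exists s g, a = sided s g.
  by case: a => g; [exists false | exists true]; exists g.
move=> x' y' z'; have [a [x ->]] := sidedE x'; have [b [y ->]] := sidedE y'.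
have [c [z ->]] := sidedE z'; have := check_sidesP a b c chk.
have valE : pick3 (sided a x) (sided b y) (sided c z)
            =1 sum_map (sym_val x y z) \o sym_vars a b c.
  have symE i s : sided s (pick3 x y z i)
                  = sum_map (sym_val x y z) (sided s (0, [:: (i, false)])).
    by case: s; rewrite /= /sym_val /word_val big_seq1 mul1g.
  by case=> [|[|i]]; rewrite /= -symE.
rewrite !(eq_teval _ _ valE) /op.
have valM := double_morph (@sym_valM x y z) (@sym_val_star x y z)
  (@sym_val_mul0 x y z) t.
rewrite -!(teval_morph _ _ valM) /check_sides.
by case: (teval _ _ _) => u; case: (teval _ _ _) => // v;
  move/(sym_eqP x y z lvlP) => /= ->.
Qed.

Definition word_of (w : word_code) : word gT :=
  [ffun p => twisted *%g star w p.1 p.2].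

Definition triple_of (t : triple_code) :=
  (word_of t.1.1, word_of t.1.2, g0w g0 (word_of t.2)).

Definition loop_of (t : triple_code) :=
  let: (beta, gamma, delta) := triple_of t in Qmul beta gamma delta.

Lemma loop_ofE t a b : loop_of t a b = op t a b.
Proof. by case: t a b => [[u v] w] [x|x] [y|y]; rewrite /loop_of /= ?ffunE. Qed.

Lemma twisted_injr w x : injective (twisted *%g star w x).
Proof.
case: w => [[sx []] []] y y' /=; rewrite /star_if.
- by move/mulIg/star_inj.
- by move/mulgI/star_inj.
- by move/mulIg.
- by move/mulgI.
Qed.

Lemma twisted_injl w y : injective (fun x => twisted *%g star w x y).
Proof.
case: w => [[[] sy] []] x x' /=; rewrite /star_if.
- by move/mulgI/star_inj.
- by move/mulIg/star_inj.
- by move/mulgI.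
- by move/mulIg.
Qed.

(** Injective self-maps of a finite set are bijective, so cancellation gives both divisions. *)
Lemma finite_is_loop (T : finType) (f : T -> T -> T) e :
  left_id e f -> right_id e f -> (forall a, injective (f a)) ->
  (forall b, injective (f^~ b)) -> is_loop f e.
Proof.
move=> lid rid injr injl; split=> // a b.
  have [g gK Kg] := injF_bij (injr a); exists (g b); split=> // x <-.
  exact: gK.
have [g gK Kg] := injF_bij (injl a); exists (g b); split=> [|x <-].
  exact: Kg.
exact: (gK x).
Qed.

Lemma op_injr t a : injective (op t a).
Proof.
case: t a => [[u v] w] [x|x] [y|y] [y'|y'] //= [].
- by move/mulgI->.
- by move/twisted_injr->.
- by move/twisted_injr->.
- by move/mulgI/twisted_injr->.
Qed.

Lemma op_injl t b : injective (op t ^~ b).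
Proof.
case: t b => [[u v] w] [y|y] [x|x] [x'|x'] //= [].
- by move/mulIg->.
- by move/twisted_injl->.
- by move/twisted_injl->.
- by move/mulgI/twisted_injl->.
Qed.

Lemma is_loop_of bs bw cw ds ds' dw :
  is_loop (loop_of (admissible_code bs bw cw ds ds' dw)) Qone.
Proof.
apply: finite_is_loop => a; rewrite ?loop_ofE.
- case: a => x /=; rewrite ?mul1g // /star_if.
  by case: bs; case: bw; rewrite ?star1 ?mul1g ?mulg1.
- case: a => x /=; rewrite ?mulg1 // /star_if.
  by case: cw; rewrite ?mul1g ?mulg1.
- by move=> x y; rewrite !loop_ofE => /op_injr.
- by move=> x y; rewrite !loop_ofE => /op_injl.
Qed.

(** * Conditions forced by the middle nuclear square law, and their sufficiency *)

Lemma MNS_identity t :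
  middle_nuclear_square_loop (loop_of t) Qone -> identity MNS_id t.
Proof. by case=> _ H x y z; have := H x y z; rewrite !loop_ofE. Qed.

Lemma required_levelP bs bw cw ds ds' dw :
  let t := admissible_code bs bw cw ds ds' dw in
  identity MNS_id t -> level (required_level t).
Proof.
move=> t MNS.
(* The middle variable is taken in [G], and the outer ones in [G] and [Gu], then [Gu] and [G], then
   both in [Gu], where [g0] cancels. *)
have beta_eq s x z : twisted *%g star (bs, false, bw) x
    (twisted *%g star (bs, false, bw) (s * s) z)
  = twisted *%g star (bs, false, bw) (x * (s * s)) z.
  by have /= [] := MNS (inl x) (inl s) (inr z).
have gamma_eq s x z : twisted *%g star (false, false, cw) x (s * s * z)
  = twisted *%g star (false, false, cw)
      (twisted *%g star (false, false, cw) x (s * s)) z.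
  by have /= [] := MNS (inr x) (inl s) (inl z).
have delta_eq s x z : twisted *%g star (ds, ds', dw) x
    (twisted *%g star (bs, false, bw) (s * s) z)
  = twisted *%g star (ds, ds', dw)
      (twisted *%g star (false, false, cw) x (s * s)) z.
  by have /= [/mulgI] := MNS (inr x) (inl s) (inr z).
(* With both outer variables equal to u, s^2 receives stars according to [bs] and [ds'] on the left
   and to [ds] on the right. *)
have fixed : bs (+) ds (+) ds' -> squares_star_fixed.
  move=> parity s; have := delta_eq s 1 1; move: parity.
  by case: (bs); case: (bw); case: (cw); case: (ds); case: (ds');
    case: (dw) => //= _; rewrite ?star1 ?mul1g ?mulg1 ?starK.
have central : required_level t != 0%N -> squares_central.
  move=> lvl0 s; apply/centralP => w.
  have s_fixed odd_stars := fixed odd_stars s.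
  (* The square becomes a single element [s]. The instances at [star w] undo a star that [delta]
     puts on its argument; in each case one instance says that [s] and [w] commute, possibly after
     starring both sides. *)
  move: (s * s) s_fixed (beta_eq s w 1) (gamma_eq s 1 w) (delta_eq s w 1)
    (delta_eq s 1 w) (delta_eq s (star w) 1) (delta_eq s 1 (star w)) lvl0.
  rewrite {}/t in MNS *.
  move=> {MNS beta_eq gamma_eq delta_eq fixed}s.
  by case: (bs); case: (bw); case: (cw); case: (ds); case: (ds');
    case: (dw) => //=;
    rewrite ?star1 ?mul1g ?mulg1 ?starM ?starK ?mulgA => sf b1 c1 d1 d2 d3 d4 _;
    try rewrite ?(sf isT) in d1 d2 d3 d4;
    match goal with E : _ = _ |- _ =>
    first [ exact E | exact (esym E)
          | apply: star_inj; rewrite !starM; first [exact E | exact (esym E)] ]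
    end.
split=> lvl.
  by apply: central; rewrite -lt0n.
apply: fixed; move: lvl; rewrite /t /required_level /admissible_code.
by case: ifP => // _; case: ifP.
Qed.

(** A computation over all 64 codes. The one code of level 0 outside [codes_b], [(cxy, cxy, cxy)],
    passes the LC check. *)
Lemma check_required_level bs bw cw ds ds' dw :
  let t := admissible_code bs bw cw ds ds' dw in
  let lvl := required_level t in
  [|| check lvl t LC_id, check lvl t RC_id, t \in codes_b,
      (lvl == 1%N) && (t \in codes_c) | (lvl == 2) && (t \in codes_d)].
Proof.
by case: bs; case: bw; case: cw; case: ds; case: ds'; case: dw; vm_compute.
Qed.

(** The necessary conditions suffice: for each of the 64 codes the symbolic check of the law
    succeeds at the required level. *)
Lemma required_level_MNS bs bw cw ds ds' dw :
  let t := admissible_code bs bw cw ds ds' dw in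
  level (required_level t) -> middle_nuclear_square_loop (loop_of t) Qone.
Proof.
move=> t lvlP; split=> [|x y z]; first exact: is_loop_of.
rewrite !loop_ofE; apply: (check_identity (id := MNS_id) lvlP).
by rewrite /t; case: (bs); case: (bw); case: (cw); case: (ds); case: (ds');
  case: (dw); vm_compute.
Qed.

End Group.

(** * From codes back to triples of words *)

Definition admissible (t : triple_code) : bool :=
  let: ((_, by_, _), (gx, gy, _), _) := t in ~~ [|| by_, gx | gy].

Lemma admissibleP t : admissible t ->
  exists bs bw cw ds ds' dw, t = admissible_code bs bw cw ds ds' dw.
Proof.
case: t => [[[[bs []] bw] [[[] []] cw]] [[ds ds'] dw]] // _.
by exists bs, bw, cw, ds, ds', dw.
Qed.

Lemma required_level_codes lvl (ts : seq triple_code) t :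
  all (fun t => admissible t && (required_level t == lvl)) ts -> t \in ts ->
  admissible t /\ required_level t = lvl.
Proof. by move=> /allP h /h /andP[? /eqP]. Qed.

Theorem theorem8p13 (gT : finGroupType) (star : gT -> gT) (g0 : gT)
    (beta gamma delta : word gT)
    (star_invol : forall g : gT, star (star g) = g)
    (star_anti : forall g h : gT, star (g * h)%g = (star h * star g)%g)
    (star_nonid : exists g : gT, star g <> g)
    (star_central : forall g : gT, (g * star g)%g \in 'Z([set: gT])%g)
    (g0_central : g0 \in 'Z([set: gT])%g)
    (g0_star : star g0 = g0)
    (beta_word : beta \in betas star)
    (gamma_word : gamma \in gammas gT)
    (delta_word : delta \in deltas star g0) :
  let L := Qmul beta gamma delta in
  let GmodZ_elem_ab_2 := (2.-abelem ([set: gT] / 'Z([set: gT])))%g in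
  middle_nuclear_square_loop L Qone <->
  [\/ LC_loop L Qone \/ RC_loop L Qone,
      (beta, gamma, delta) \in triples_b star g0,
      GmodZ_elem_ab_2 /\ (beta, gamma, delta) \in triples_c star g0
    | [/\ GmodZ_elem_ab_2,
          forall x : gT, star (x * x)%g = (x * x)%g
        & (beta, gamma, delta) \in triples_d star g0]].
Proof.
have betaP : exists bs bw, beta = word_of star (bs, false, bw).
  move: beta_word; rewrite !inE => /or4P[] /eqP->.
  - by exists false, false.
  - by exists true, false.
  - by exists false, true.
  - by exists true, true.
have gammaP : exists cw, gamma = word_of star (false, false, cw).
  by move: gamma_word; rewrite !inE => /orP[] /eqP->;
    [exists false | exists true].
have deltaP : exists d, delta = g0w g0 (word_of star d).
  have: delta \in [seq g0w g0 (word_of star d) | d <-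
     [:: cxy; cxys; cxsy; cxsys; cyx; cyxs; cysx; cysxs]] := delta_word.
  by case/mapP=> d _ ->; exists d.
have {betaP} [bs [bw betaE]] := betaP; have {gammaP} [cw gammaE] := gammaP.
have {deltaP} [[[ds ds'] dw] deltaE] := deltaP.
pose t := admissible_code bs bw cw ds ds' dw.
have tripleE : (beta, gamma, delta) = triple_of star g0 t.
  by rewrite betaE gammaE deltaE.
have bE : triples_b star g0 = map (triple_of star g0) codes_b by [].
have cE : triples_c star g0 = map (triple_of star g0) codes_c by [].
have dE : triples_d star g0 = map (triple_of star g0) codes_d by [].
have abelemE := abelem_squares_central gT.
(* Distinct codes may define the same functions, so membership in a list only yields some code [t']
   of the triple, possibly different from [t]. *)
have MNS_of t' (lvl : nat) ts : (beta, gamma, delta) = triple_of star g0 t' ->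
    all (fun t => admissible t && (required_level t == lvl)) ts -> t' \in ts ->
    level star lvl -> middle_nuclear_square_loop (Qmul beta gamma delta) Qone.
  move=> [-> -> ->] ts_lvl /(required_level_codes ts_lvl)[/admissibleP].
  case=> [bs' [bw' [cw' [es [es' [ew ->]]]]]] <-.
  exact: required_level_MNS.
rewrite /=; split=> [MNS|].
  have loopE : Qmul beta gamma delta = loop_of star g0 t.
    by case: tripleE => -> -> ->.
  have loopP : is_loop (loop_of star g0 t) Qone by exact: is_loop_of.
  have lvlP : level star (required_level t).
    by move: MNS; rewrite loopE => /MNS_identity; apply: required_levelP.
  have id_of id : check (required_level t) t id -> identity star g0 id t.
    by apply: check_identity.
  rewrite tripleE bE cE dE loopE.
  have /or4P[||t_b|/orP[]/andP[/eqP lvl t_cd]] :=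
    check_required_level bs bw cw ds ds' dw.
  - move/id_of=> LC; apply: Or41; left; split=> // x y z.
    by rewrite !loop_ofE; apply: LC.
  - move/id_of=> RC; apply: Or41; right; split=> // x y z.
    by rewrite !loop_ofE; apply: RC.
  - by apply: Or42; apply: map_f.
  - apply: Or43; split; last exact: map_f.
    by apply/abelemE; case: lvlP => + _; apply; rewrite lvl.
  - apply: Or44; split; last exact: map_f.
      by apply/abelemE; case: lvlP => + _; apply; rewrite lvl.
    by case: lvlP => _; apply; rewrite lvl.
case=> [[]|t_b|[sqZ t_c]|[sqZ sq_fixed t_d]].
- exact: LC_middle_nuclear_square.
- exact: RC_middle_nuclear_square.
- move: t_b; rewrite bE => /mapP[t' t'_b /MNS_of h].
  by apply: (h 0 codes_b).
- move: t_c; rewrite cE => /mapP[t' t'_c /MNS_of h].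
  by apply: (h 1%N codes_c) => //; split=> // _; apply/abelemE.
- move: t_d; rewrite dE => /mapP[t' t'_d /MNS_of h].
  by apply: (h 2 codes_d) => //; split=> // _; apply/abelemE.
Qed.
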